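(* Consider the linearized aided INS with $s>1$ plane features $\boldsymbol\Pi_1,\dots,\boldsymbol\Pi_s$ in the state vector, fix $i\ne j$ in $\{1,\dots,s\}$, and let $$\mathbf N_\Pi=\begin{bmatrix}\mathbf N_g&\mathbf 0_{12\times3}&\mathbf N_{i\times j}\\-\lfloor\mathbf P_1\times\rfloor\mathbf g&\mathbf R_{\Pi_i}&\mathbf 0_{3\times1}\\-\lfloor\boldsymbol\Pi_1\times\rfloor\mathbf g&\mathbf n_{\pi_1}\mathbf e_3^\top\mathbf R_{\Pi_1}^\top\mathbf R_{\Pi_i}&\mathbf 0_{3\times1}\\\vdots&\vdots&\vdots\\-\lfloor\boldsymbol\Pi_s\times\rfloor\mathbf g&\mathbf n_{\pi_s}\mathbf e_3^\top\mathbf R_{\Pi_s}^\top\mathbf R_{\Pi_i}&\mathbf 0_{3\times1}\end{bmatrix}.$$ Then: (i) if $s=2$ and the two planes are not parallel, the system has at least 5 unobservable directions, given by the 5 columns of $\mathbf N_\Pi$; (ii) if $s\ge3$ and the planes' intersections are not parallel, the system has at least 4 unobservable directions, given by the first 4 columns of $\mathbf N_\Pi$. Here ''unobservable directions given by'' certain columns means that these columns are linearly independent and lie in the right null space of the observability matrix $\mathbf M$.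
   Context: $\lfloor\mathbf a\times\rfloor$ is the skew-symmetric matrix with $\lfloor\mathbf a\times\rfloor\mathbf b=\mathbf a\times\mathbf b$; $\mathbf e_i$ is the $i$-th standard basis vector of $\mathbb R^3$. All quantities below are evaluated at linearization points (state estimates); the same state variable always uses the same linearization point. At time steps $k=1,2,\dots$ (times $t_k$, $\delta t_k=t_k-t_1$), $\mathbf R_k\in SO(3)$ is the rotation from the global frame to the IMU/sensor frame, $\mathbf P_k,\mathbf V_k\in\mathbb R^3$ are IMU position and velocity in the global frame; $\mathbf g=(0,0,-g)^\top$, $g>0$, is gravity. For a continuous time $\tau$, $\mathbf R(\tau)$ and $\mathbf a(\tau)$ denote IMU orientation and IMU-frame linear acceleration. Error state ordering: (orientation error $\delta\boldsymbol\theta$, gyro bias, velocity, accelerometer bias, position, feature errors); the first five blocks are 3-dimensional and the feature block has dimension $m$. State transition matrix: $$\boldsymbol\Phi_{(k,1)}=\begin{bmatrix}\Phi_{11}&\Phi_{12}&0&0&0&0\\0&\mathbf I_3&0&0&0&0\\\Phi_{31}&\Phi_{32}&\mathbf I_3&\Phi_{34}&0&0\\0&0&0&\mathbf I_3&0&0\\\Phi_{51}&\Phi_{52}&\Phi_{53}&\Phi_{54}&\mathbf I_3&0\\0&0&0&0&0&\mathbf I_m\end{bmatrix},$$ $\Phi_{11}=\mathbf R_k\mathbf R_1^\top$, $\Phi_{31}=-\lfloor(\mathbf V_k-\mathbf V_1+\mathbf g\,\delta t_k)\times\rfloor\mathbf R_1^\top$, $\Phi_{51}=\lfloor(\mathbf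 P_1+\mathbf V_1\delta t_k-\tfrac12\mathbf g\,\delta t_k^2-\mathbf P_k)\times\rfloor\mathbf R_1^\top$, $\Phi_{53}=\mathbf I_3\delta t_k$, $\Phi_{12}=-\int_{t_1}^{t_k}\mathbf R_k\mathbf R(\tau)^\top d\tau$, $\Phi_{32}=\int_{t_1}^{t_k}\mathbf R(s)^\top\lfloor\mathbf a(s)\times\rfloor\int_{t_1}^{s}\mathbf R(s)\mathbf R(\tau)^\top d\tau\,ds$, $\Phi_{52}=\int_{t_1}^{t_k}\int_{t_1}^{\theta}\mathbf R(s)^\top\lfloor\mathbf a(s)\times\rfloor\int_{t_1}^{s}\mathbf R(s)\mathbf R(\tau)^\top d\tau\,ds\,d\theta$, $\Phi_{34}=-\int_{t_1}^{t_k}\mathbf R(\tau)^\top d\tau$, $\Phi_{54}=-\int_{t_1}^{t_k}\int_{t_1}^{s}\mathbf R(\tau)^\top d\tau\,ds$ (inside these integrals $s$ is an integration variable). Plane features. Plane $q\in\{1,\dots,s\}$ is represented by its closest point to the origin, $\boldsymbol\Pi_q=d_q\mathbf n_{\pi_q}\in\mathbb R^3$ (global frame), with unit normal $\mathbf n_{\pi_q}$ and distance $d_q\ne0$; the feature block is the concatenation over $q$ ($m=3s$). The direct measurement of plane $q$ is its closest point in the sensor frame, $(d_q-\mathbf n_{\pi_q}^\top\mathbf P_k)\mathbf R_k\mathbf n_{\pi_q}$; its Jacobian $\mathbf H_k^{\Pi_q}$, written with the blocks (IMU orientation; gyro bias, velocity, accelerometer bias; position; plane $q$), is $$\mathbf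 R_k\begin{bmatrix}\mathbf H_{\pi1}&\mathbf 0_{3\times9}&-\mathbf n_{\pi_q}\mathbf n_{\pi_q}^\top&\mathbf H_{\pi2}\end{bmatrix}$$ with zero blocks for the other planes, where $\mathbf H_{\pi1}=(d_q-\mathbf n_{\pi_q}^\top\mathbf P_k)\lfloor\mathbf n_{\pi_q}\times\rfloor\mathbf R_k^\top$, $\mathbf H_{\pi2}=\frac1{d_q}\left[(d_q-\mathbf n_{\pi_q}^\top\mathbf P_k)\mathbf I_3-\mathbf n_{\pi_q}\mathbf P_k^\top+2(\mathbf n_{\pi_q}^\top\mathbf P_k)\mathbf n_{\pi_q}\mathbf n_{\pi_q}^\top\right]$. $\mathbf H_k$ stacks $\mathbf H_k^{\Pi_1},\dots,\mathbf H_k^{\Pi_s}$; the observability matrix $\mathbf M$ stacks $\mathbf H_k\boldsymbol\Phi_{(k,1)}$ over $k=1,2,\dots$. For each $q$, $\mathbf R_{\Pi_q}\in SO(3)$ is a rotation matrix whose third column is $\mathbf n_{\pi_q}$ (the first two columns being unit vectors orthogonal to each other and to $\mathbf n_{\pi_q}$). $\mathbf N_g=\begin{bmatrix}(\mathbf R_1\mathbf g)^\top&\mathbf 0_{1\times3}&-(\lfloor\mathbf V_1\times\rfloor\mathbf g)^\top&\mathbf 0_{1\times3}\end{bmatrix}^\top\in\mathbb R^{12}$ and $\mathbf N_{i\times j}=\begin{bmatrix}\mathbf 0_{1\times6}&(\mathbf n_{\pi_i}\times\mathbf n_{\pi_j})^\top&\mathbf 0_{1\times3}\end{bmatrix}^\top\in\mathbb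 R^{12}$. *)

(* Defs.v *)
From HB Require Import structures.
From mathcomp Require Import all_boot all_order all_algebra.
From mathcomp Require Import all_classical all_reals all_analysis.

Set Implicit Arguments.
Unset Strict Implicit.
Unset Printing Implicit Defensive.

Import Order.TTheory GRing.Theory Num.Theory.

Local Open Scope classical_set_scope.
Local Open Scope ring_scope.

Definition dot3 (R : realType) (u v : 'cV[R]_3) : R := (u^T *m v) 0 0.

Definition cross3 (R : realType) (a b : 'cV[R]_3) : 'cV[R]_3 :=
  \col_i (a (i + 1) 0 * b (i + 2) 0 - a (i + 2) 0 * b (i + 1) 0).
  (* [i + 1] and [i + 2] are computed in ['I_3], i.e. modulo 3 *)

Definition e3 (R : realType) : 'cV[R]_3 := delta_mx ord_max 0.

(* Column j is a x e_j; see [skew3E]. *)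
Definition skew3 (R : realType) (a : 'cV[R]_3) : 'M[R]_3 :=
  \matrix_(i, j) cross3 a (delta_mx j 0) i 0.

Lemma skew3E (R : realType) (a b : 'cV[R]_3) : skew3 a *m b = cross3 a b.
Proof.
apply/colP => i; rewrite !mxE.
transitivity (\sum_j (a (i + 1) 0 * (b j 0 *+ (j == i + 2)) -
                      a (i + 2) 0 * (b j 0 *+ (j == i + 1)))).
  apply: eq_bigr => j _; rewrite !mxE !eqxx !andbT ![_ == j]eq_sym.
  rewrite mulrBl -!mulrA; congr (_ * _ - _ * _).
    by case: (j == _); rewrite ?mul1r ?mul0r.
  by case: (j == _); rewrite ?mul1r ?mul0r.
rewrite sumrB -!mulr_sumr; congr (_ * _ - _ * _).
  by rewrite (bigD1 (i + 2)) //= eqxx big1 ?addr0 // => j /negPf ->.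
by rewrite (bigD1 (i + 1)) //= eqxx big1 ?addr0 // => j /negPf ->.
Qed.

Definition SO3 (R : realType) (A : 'M[R]_3) : Prop :=
  A *m A^T = 1%:M /\ \det A = 1.

(* Only applied to nonzero vectors. *)
Definition parallel (R : realType) (u v : 'cV[R]_3) : Prop :=
  exists c : R, u = c *: v.

(* Entrywise integral over [a, b]; only used with a <= b. *)
Definition mxint (R : realType) (m n : nat) (a b : R) (F : R -> 'M[R]_(m, n)) :
    'M[R]_(m, n) :=
  \matrix_(i, j) \int[lebesgue_measure]_(x in `[a, b]) F x i j.

(* Discrete-time sequences are indexed from 1; their values at 0 are not used.
   No relation is imposed between the estimates at the time steps and the
   continuous-time signals [ins_Rc] and [ins_acc]. *)
Record ins (R : realType) := MkIns {
  ins_tm : nat -> R;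
  ins_rot : nat -> 'M[R]_3;
  ins_pos : nat -> 'cV[R]_3;
  ins_vel : nat -> 'cV[R]_3;
  ins_Rc : R -> 'M[R]_3;
  ins_acc : R -> 'cV[R]_3;
  ins_g : R;
  ins_tm_incr : forall k l, (0 < k)%N -> (k < l)%N -> ins_tm k < ins_tm l;
  ins_rot_SO3 : forall k, (0 < k)%N -> SO3 (ins_rot k);
  ins_Rc_SO3 : forall tau, SO3 (ins_Rc tau);
  ins_g_gt0 : 0 < ins_g
}.

Definition ins_grav (R : realType) (X : ins R) : 'cV[R]_3 := - (ins_g X *: e3 R).

Definition ins_dt (R : realType) (X : ins R) (k : nat) : R := ins_tm X k - ins_tm X 1.

Record plane (R : realType) := MkPlane {
  pl_n : 'cV[R]_3;
  pl_d : R;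
  pl_rot : 'M[R]_3;
  pl_n_unit : dot3 pl_n pl_n = 1;
  pl_d_neq0 : pl_d != 0;
  pl_rot_SO3 : SO3 pl_rot;
  pl_rot_col3 : col ord_max pl_rot = pl_n
}.

(* Closest point of the plane to the origin. *)
Definition cp (R : realType) (p : plane R) : 'cV[R]_3 := pl_d p *: pl_n p.

(* Dimension of the feature block; provably 3 * s.  The sum is the height of
   a [\mxcol_(q < s)] of blocks of height 3. *)
Definition fdim (s : nat) : nat := \sum_(q < s) 3.

(* Orientation, gyro bias, velocity and accelerometer bias. *)
Notation idim := (3 + (3 + (3 + 3)))%N.

Definition col4 (R : realType) (n : nat) (a b c d : 'M[R]_(3, n)) :
  'M[R]_(idim, n) := col_mx a (col_mx b (col_mx c d)).

Definition row6 (R : realType) (r m : nat) (a b c d e : 'M[R]_(r, 3))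
    (f : 'M[R]_(r, m)) : 'M[R]_(r, idim + (3 + m)) :=
  row_mx (row_mx a (row_mx b (row_mx c d))) (row_mx e f).

Definition col6 (R : realType) (n m : nat) (a b c d e : 'M[R]_(3, n))
    (f : 'M[R]_(m, n)) : 'M[R]_(idim + (3 + m), n) :=
  col_mx (col4 a b c d) (col_mx e f).

Definition Phi11 (R : realType) (X : ins R) (k : nat) : 'M[R]_3 :=
  ins_rot X k *m (ins_rot X 1)^T.

Definition Phi31 (R : realType) (X : ins R) (k : nat) : 'M[R]_3 :=
  - (skew3 (ins_vel X k - ins_vel X 1 + ins_dt X k *: ins_grav X)
       *m (ins_rot X 1)^T).

Definition Phi51 (R : realType) (X : ins R) (k : nat) : 'M[R]_3 :=
  skew3 (ins_pos X 1 + ins_dt X k *: ins_vel X 1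
         - (2^-1 * ins_dt X k ^+ 2) *: ins_grav X - ins_pos X k)
    *m (ins_rot X 1)^T.

Definition Phi53 (R : realType) (X : ins R) (k : nat) : 'M[R]_3 := (ins_dt X k)%:M.

Definition Phi12 (R : realType) (X : ins R) (k : nat) : 'M[R]_3 :=
  - mxint (ins_tm X 1) (ins_tm X k) (fun tau => ins_rot X k *m (ins_Rc X tau)^T).

Definition Phi_integrand (R : realType) (X : ins R) (s : R) : 'M[R]_3 :=
  (ins_Rc X s)^T *m skew3 (ins_acc X s)
    *m mxint (ins_tm X 1) s (fun tau => ins_Rc X s *m (ins_Rc X tau)^T).

Definition Phi32 (R : realType) (X : ins R) (k : nat) : 'M[R]_3 :=
  mxint (ins_tm X 1) (ins_tm X k) (Phi_integrand X).

Definition Phi52 (R : realType) (X : ins R) (k : nat) : 'M[R]_3 :=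
  mxint (ins_tm X 1) (ins_tm X k) (fun theta => mxint (ins_tm X 1) theta (Phi_integrand X)).

Definition Phi34 (R : realType) (X : ins R) (k : nat) : 'M[R]_3 :=
  - mxint (ins_tm X 1) (ins_tm X k) (fun tau => (ins_Rc X tau)^T).

Definition Phi54 (R : realType) (X : ins R) (k : nat) : 'M[R]_3 :=
  - mxint (ins_tm X 1) (ins_tm X k)
      (fun s => mxint (ins_tm X 1) s (fun tau => (ins_Rc X tau)^T)).

Definition Phi (R : realType) (X : ins R) (m k : nat) :
    'M[R]_(idim + (3 + m)) :=
  col6
    (row6 (Phi11 X k) (Phi12 X k) 0           0           0    0)
    (row6 0           1%:M        0           0           0    0)
    (row6 (Phi31 X k) (Phi32 X k) 1%:M        (Phi34 X k) 0    0)
    (row6 0           0           0           1%:M        0    0)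
    (row6 (Phi51 X k) (Phi52 X k) (Phi53 X k) (Phi54 X k) 1%:M 0)
    (row6 0           0           0           0           0    1%:M).

(* Blocks of the Jacobian of (d - n . P_k) R_k n, the closest point of the
   plane in the sensor frame. *)
Definition Hpi1 (R : realType) (X : ins R) (p : plane R) (k : nat) : 'M[R]_3 :=
  (pl_d p - dot3 (pl_n p) (ins_pos X k)) *: (skew3 (pl_n p) *m (ins_rot X k)^T).

Definition Hpi2 (R : realType) (X : ins R) (p : plane R) (k : nat) : 'M[R]_3 :=
  (pl_d p)^-1 *:
    ((pl_d p - dot3 (pl_n p) (ins_pos X k))%:M - pl_n p *m (ins_pos X k)^T
     + (2 * dot3 (pl_n p) (ins_pos X k)) *: (pl_n p *m (pl_n p)^T)).

Definition Hplane (R : realType) (X : ins R) (s : nat) (pl : 'I_s -> plane R)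
    (q : 'I_s) (k : nat) : 'M[R]_(3, idim + (3 + fdim s)) :=
  ins_rot X k *m
    row6 (Hpi1 X (pl q) k) 0 0 0 (- (pl_n (pl q) *m (pl_n (pl q))^T))
         (\mxrow_(l < s) (if l == q then Hpi2 X (pl q) k else 0)).

Definition Hmx (R : realType) (X : ins R) (s : nat) (pl : 'I_s -> plane R)
    (k : nat) : 'M[R]_(fdim s, idim + (3 + fdim s)) :=
  \mxcol_(q < s) Hplane X pl q k.

(* The observability matrix has infinitely many block rows, indexed by k >= 1. *)
Definition obs_mx (R : realType) (X : ins R) (s : nat) (pl : 'I_s -> plane R)
    (k : nat) : 'M[R]_(fdim s, idim + (3 + fdim s)) :=
  Hmx X pl k *m Phi X (fdim s) k.

Definition in_null_obs (R : realType) (X : ins R) (s : nat)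
    (pl : 'I_s -> plane R) (v : 'cV[R]_(idim + (3 + fdim s))) : Prop :=
  forall k, (0 < k)%N -> obs_mx X pl k *m v = 0.

Definition unobservable_directions (R : realType) (X : ins R) (s : nat)
    (pl : 'I_s -> plane R) (n : nat) (N : 'M[R]_(idim + (3 + fdim s), n)) :
    Prop :=
  row_free N^T /\ forall l : 'I_n, in_null_obs X pl (col l N).

Definition Ng (R : realType) (X : ins R) : 'cV[R]_idim :=
  col4 (ins_rot X 1 *m ins_grav X) 0 (- (skew3 (ins_vel X 1) *m ins_grav X)) 0.

Definition Ncross (R : realType) (p q : plane R) : 'cV[R]_idim :=
  col4 0 0 (cross3 (pl_n p) (pl_n q)) 0.

(* The width 1 + 3 + 1 parses as (1 + 3) + 1, so that [lsubmx] extracts the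
   first four columns. *)
Definition NPi (R : realType) (X : ins R) (s : nat) (pl : 'I_s -> plane R)
    (i j : 'I_s) : 'M[R]_(idim + (3 + fdim s), 1 + 3 + 1) :=
  col_mx
    (row_mx (row_mx (Ng X) 0) (Ncross (pl i) (pl j)))
    (col_mx
      (row_mx (row_mx (- (skew3 (ins_pos X 1) *m ins_grav X)) (pl_rot (pl i))) 0)
      (\mxcol_(q < s)
        row_mx (row_mx (- (skew3 (cp (pl q)) *m ins_grav X))
                       (pl_n (pl q) *m (e3 R)^T *m (pl_rot (pl q))^T
                          *m pl_rot (pl i)))
               0)).

Definition plane_points (R : realType) (p : plane R) : set 'cV[R]_3 :=
  [set x | dot3 (pl_n p) x = pl_d p].

(* Coincident planes count as parallel. *)
Definition parallel_planes (R : realType) (p q : plane R) : Prop :=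
  parallel (pl_n p) (pl_n q).

Definition line_along (R : realType) (L : set 'cV[R]_3) (u : 'cV[R]_3) : Prop :=
  u != 0 /\ exists x0 : 'cV[R]_3, L = [set x0 + c *: u | c in [set: R]].

(* The lines in which pairs of planes meet do not all have the same
   direction. *)
Definition intersections_not_parallel (R : realType) (s : nat)
    (pl : 'I_s -> plane R) : Prop :=
  exists (a b c d : 'I_s) (u v : 'cV[R]_3),
    [/\ line_along (plane_points (pl a) `&` plane_points (pl b)) u,
        line_along (plane_points (pl c) `&` plane_points (pl d)) v
      & ~ parallel u v].

(* Main.v *)
(* With [n = pl_n q], [P = ins_pos k] and [w] the image of a vector under the
   position rows of [Phi], the block row of plane [q] maps a vector without bias
   components, orientation [y] and feature [f] to
   [R_k ((d - n.P) n x (R_1^T y) - n (n.w) + Hpi2 f)].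
   For the gravity column the velocity and acceleration terms drop out of
   [w], leaving [- P x g], and the two remaining terms along [n] cancel because
   [P.(n x g) = - n.(P x g)].  For the position columns [Hpi2 n = n].  For the
   last column only [n.(n_i x n_j)] occurs, which vanishes because two planes
   leave no other normal.
   Independence: [R_1 g <> 0] isolates the gravity column in the orientation
   rows, then [n_i x n_j <> 0] the last one in the velocity rows, and [pl_rot i]
   is invertible in the position rows. *)
Require Import Defs.
From HB Require Import structures.
From mathcomp Require Import all_boot all_order all_algebra.
From mathcomp Require Import all_classical all_reals all_analysis.
From mathcomp Require Import ring.

Import Order.TTheory GRing.Theory Num.Theory.

Local Open Scope ring_scope.

(** * Dot and cross products in coordinates *)

Section CrossProduct.
Context {R : realType}.
Implicit Types (u v w : 'cV[R]_3) (c : R).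

Let o0 : 'I_3 := ord0.
Let o1 : 'I_3 := Ordinal (isT : (1 < 3)%N).
Let o2 : 'I_3 := Ordinal (isT : (2 < 3)%N).

Lemma dot3E u v : dot3 u v = u o0 0 * v o0 0 + u o1 0 * v o1 0 + u o2 0 * v o2 0.
Proof.
rewrite /dot3 mxE 3!big_ord_recl big_ord0 addr0 addrA !mxE.
by congr (_ * _ + _ * _ + _ * _); congr (fun_of_matrix _ _ _); apply: val_inj.
Qed.

Lemma cross3E u v :
  [/\ cross3 u v o0 0 = u o1 0 * v o2 0 - u o2 0 * v o1 0,
      cross3 u v o1 0 = u o2 0 * v o0 0 - u o0 0 * v o2 0
    & cross3 u v o2 0 = u o0 0 * v o1 0 - u o1 0 * v o0 0].
Proof.
by split; rewrite mxE; congr (_ * _ - _ * _); congr (fun_of_matrix _ _ _);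
  apply: val_inj.
Qed.

Lemma col3P u v :
  u o0 0 = v o0 0 -> u o1 0 = v o1 0 -> u o2 0 = v o2 0 -> u = v.
Proof.
move=> e0 e1 e2; apply/colP => -[[|[|[|//]]] lt3].
- by rewrite (_ : Ordinal lt3 = o0) //; apply: val_inj.
- by rewrite (_ : Ordinal lt3 = o1) //; apply: val_inj.
- by rewrite (_ : Ordinal lt3 = o2) //; apply: val_inj.
Qed.

Lemma tr_mul3 u v : u^T *m v = (dot3 u v)%:M.
Proof. by rewrite [LHS]mx11_scalar. Qed.

Lemma dot3C u v : dot3 u v = dot3 v u.
Proof. by rewrite !dot3E; ring. Qed.

Lemma cross3vv u : cross3 u u = 0.
Proof.
by have [e0 e1 e2] := cross3E u u; apply: col3P; rewrite ?e0 ?e1 ?e2 mxE; ring.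
Qed.

Lemma dot3_crossl u v : dot3 u (cross3 u v) = 0.
Proof. by have [e0 e1 e2] := cross3E u v; rewrite dot3E e0 e1 e2; ring. Qed.

Lemma dot3_crossr u v : dot3 v (cross3 u v) = 0.
Proof. by have [e0 e1 e2] := cross3E u v; rewrite dot3E e0 e1 e2; ring. Qed.

Lemma dot3_crossCA u v w : dot3 u (cross3 v w) = - dot3 v (cross3 u w).
Proof.
have [e0 e1 e2] := cross3E u w; have [f0 f1 f2] := cross3E v w.
by rewrite !dot3E e0 e1 e2 f0 f1 f2; ring.
Qed.

Lemma cross3A u v w : cross3 u (cross3 v w) = dot3 u w *: v - dot3 u v *: w.
Proof.
have [e0 e1 e2] := cross3E u (cross3 v w); have [f0 f1 f2] := cross3E v w.
by apply: col3P; rewrite ?e0 ?e1 ?e2 ?f0 ?f1 ?f2 !mxE !dot3E; ring.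
Qed.

(** Expanding v x (u x v) = (v.v) u - (v.u) v with v a unit vector gives u = (v.u) v. *)
Lemma cross3_eq0_parallel u v :
  dot3 v v = 1 -> cross3 u v = 0 -> parallel u v.
Proof.
move=> v1 uv0; exists (dot3 v u); apply/eqP; rewrite -subr_eq0.
by rewrite -[u in u - _]scale1r -v1 -cross3A uv0 -skew3E mulmx0.
Qed.

Lemma cross3Dl u v w : cross3 (u + v) w = cross3 u w + cross3 v w.
Proof. by apply/colP => l; rewrite !mxE; ring. Qed.

Lemma cross3Nl u w : cross3 (- u) w = - cross3 u w.
Proof. by apply/colP => l; rewrite !mxE; ring. Qed.

Lemma cross3Zl c u w : cross3 (c *: u) w = c *: cross3 u w.
Proof. by apply/colP => l; rewrite !mxE; ring. Qed.

Lemma SO3_trmul (A : 'M[R]_3) : SO3 A -> A^T *m A = 1%:M.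
Proof. by case=> + _ => /mulmx1C. Qed.

End CrossProduct.

(** * Block products with the transition matrix *)

Lemma mxcol_row_mx (T : Type) (s : nat) (p : 'I_s -> nat) (m n : nat)
    (A : forall q, 'M[T]_(p q, m)) (B : forall q, 'M[T]_(p q, n)) :
  \mxcol_(q < s) row_mx (A q) (B q) = row_mx (\mxcol_q A q) (\mxcol_q B q).
Proof.
apply/matrixP => a b; rewrite !mxE.
by case: (fintype.split b) => b'; rewrite !mxE.
Qed.

Lemma col_mx_row_mx (T : Type) (m1 m2 n1 n2 : nat) (A : 'M[T]_(m1, n1))
    (B : 'M[T]_(m1, n2)) (C : 'M[T]_(m2, n1)) (D : 'M[T]_(m2, n2)) :
  col_mx (row_mx A B) (row_mx C D) = row_mx (col_mx A C) (col_mx B D).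
Proof. by rewrite -block_mxEv block_mxEh. Qed.

Section Blocks.
Context {R : realType} {m : nat}.

Lemma mul_row6_col6 (r n : nat) (a b c d e : 'M[R]_(r, 3)) (f : 'M[R]_(r, m))
    (a' b' c' d' e' : 'M[R]_(3, n)) (f' : 'M[R]_(m, n)) :
  row6 a b c d e f *m col6 a' b' c' d' e' f' =
  a *m a' + (b *m b' + (c *m c' + d *m d')) + (e *m e' + f *m f').
Proof. by rewrite /row6 /col6 /col4 !mul_row_col. Qed.

Lemma mul_col6 (r p n : nat) (a b c d e : 'M[R]_(3, p)) (f : 'M[R]_(r, p))
    (M : 'M[R]_(p, n)) :
  col6 a b c d e f *m M =
  col6 (a *m M) (b *m M) (c *m M) (d *m M) (e *m M) (f *m M).
Proof. by rewrite /col6 /col4 !mul_col_mx. Qed.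

(** Zero bias components remove every block of [Phi] that holds an integral, so only closed-form
    blocks remain. *)
Lemma Phi_mul_col6 (X : ins R) (k n : nat) (x v p : 'M[R]_(3, n))
    (f : 'M[R]_(m, n)) :
  Phi X m k *m col6 x 0 v 0 p f =
  col6 (Phi11 X k *m x) 0 (Phi31 X k *m x + v) 0
       (Phi51 X k *m x + ins_dt X k *: v + p) f.
Proof.
rewrite /Phi mul_col6 !mul_row6_col6.
by rewrite !(mulmx0, mul0mx, mul1mx, addr0, add0r) /Phi53 mul_scalar_mx.
Qed.

Lemma col6_eq0 (n : nat) (a b c d e : 'M[R]_(3, n)) (f : 'M[R]_(m, n)) :
  col6 a b c d e f = 0 -> [/\ a = 0, c = 0 & e = 0].
Proof.
move/eqP; rewrite /col6 /col4 !col_mx_eq0.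
by case/andP => /and4P[/eqP-> _ /eqP-> _] /andP[/eqP-> _].
Qed.

End Blocks.

(** * Jacobian blocks and the null space of the observability matrix *)

Section Observability.
Context {R : realType} (X : ins R) {s : nat} (pl : 'I_s -> plane R).

Lemma Hplane_mul_col6 (q : 'I_s) (k n : nat) (x b v a p : 'M[R]_(3, n))
    (f : 'I_s -> 'M[R]_(3, n)) :
  Hplane X pl q k *m col6 x b v a p (\mxcol_l f l) =
  ins_rot X k *m (Hpi1 X (pl q) k *m x - pl_n (pl q) *m (pl_n (pl q))^T *m p
                  + Hpi2 X (pl q) k *m f q).
Proof.
rewrite /Hplane -[LHS]mulmxA mul_row6_col6 !mul0mx !addr0 mulNmx addrA.
rewrite mul_mxrow_mxcol (bigD1 q) //= eqxx big1 ?addr0 // => l /negPf->.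
by rewrite mul0mx.
Qed.

Lemma Hpi1_mul_Phi11 (p : plane R) (k : nat) : (0 < k)%N ->
  Hpi1 X p k *m Phi11 X k =
  (pl_d p - dot3 (pl_n p) (ins_pos X k)) *: (skew3 (pl_n p) *m (ins_rot X 1)^T).
Proof.
move=> k0; rewrite /Hpi1 /Phi11 -scalemxAl; congr (_ *: _).
by rewrite -mulmxA (mulmxA _^T) (SO3_trmul _ (@ins_rot_SO3 _ X k k0)) mul1mx.
Qed.

(** One identity per plane suffices, since R_k factors out of each block row. The width [n] lets the
    three position columns be treated together. *)
Lemma obs_mx_mul_col6 (k n : nat) (x v p : 'M[R]_(3, n))
    (f : 'I_s -> 'M[R]_(3, n)) : (0 < k)%N ->
  (forall q, let nq := pl_n (pl q) in
     (pl_d (pl q) - dot3 nq (ins_pos X k)) *: (skew3 nq *m ((ins_rot X 1)^T *m x))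
     - nq *m nq^T *m (Phi51 X k *m x + ins_dt X k *: v + p)
     + Hpi2 X (pl q) k *m f q = 0) ->
  obs_mx X pl k *m col6 x 0 v 0 p (\mxcol_l f l) = 0.
Proof.
move=> k0 Hq; rewrite /obs_mx -mulmxA Phi_mul_col6 /Hmx mxcol_mul.
rewrite -[RHS]mxcol0; apply: eq_mxcol => q.
rewrite Hplane_mul_col6 (mulmxA (Hpi1 _ _ _)) Hpi1_mul_Phi11 // -scalemxAl -mulmxA.
by rewrite Hq mulmx0.
Qed.

(** Orthogonality kills the n n^T term, and d cancels its inverse. Meant for u = n x g, as the
    closest point is d n. *)
Lemma Hpi2_mul_orth (p : plane R) (k : nat) (u : 'cV[R]_3) :
  dot3 (pl_n p) u = 0 ->
  Hpi2 X p k *m (pl_d p *: u) =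
  (pl_d p - dot3 (pl_n p) (ins_pos X k)) *: u - dot3 (ins_pos X k) u *: pl_n p.
Proof.
move=> nu; rewrite /Hpi2 -scalemxAl -scalemxAr scalerA mulVf ?pl_d_neq0 // scale1r.
rewrite !mulmxDl mulNmx mul_scalar_mx -mulmxA tr_mul3 mul_mx_scalar.
by rewrite -scalemxAl -mulmxA tr_mul3 nu mul_mx_scalar scale0r scaler0 addr0.
Qed.

Lemma Hpi2_normal (p : plane R) (k : nat) : Hpi2 X p k *m pl_n p = pl_n p.
Proof.
rewrite /Hpi2 -scalemxAl !mulmxDl mulNmx mul_scalar_mx -mulmxA tr_mul3.
rewrite mul_mx_scalar -scalemxAl -mulmxA tr_mul3 pl_n_unit mulmx1.
(* The coefficients along n add up to (d - n.P) - n.P + 2 n.P = d. *)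
rewrite (dot3C (ins_pos X k)) -scalerBl -scalerDl scalerA.
rewrite -[RHS]scale1r; congr (_ *: _).
have d0 := pl_d_neq0 p; by field.
Qed.

Lemma e3_rotT (p : plane R) : (e3 R)^T *m (pl_rot p)^T = (pl_n p)^T.
Proof. by rewrite -trmx_mul /e3 -colE pl_rot_col3. Qed.

Lemma NPiE (i j : 'I_s) :
  NPi X pl i j =
  row_mx
    (row_mx
      (col6 (ins_rot X 1 *m ins_grav X) 0 (- (skew3 (ins_vel X 1) *m ins_grav X)) 0
            (- (skew3 (ins_pos X 1) *m ins_grav X))
            (\mxcol_q (- (skew3 (cp (pl q)) *m ins_grav X))))
      (col6 0 0 0 0 (pl_rot (pl i))
            (\mxcol_q (pl_n (pl q) *m (pl_n (pl q))^T *m pl_rot (pl i)))))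
    (col6 0 0 (cross3 (pl_n (pl i)) (pl_n (pl j))) 0 0 (\mxcol_q 0)).
Proof.
have rotE q : pl_n (pl q) *m (e3 R)^T *m (pl_rot (pl q))^T *m pl_rot (pl i) =
    pl_n (pl q) *m (pl_n (pl q))^T *m pl_rot (pl i).
  by rewrite -(mulmxA (pl_n _)) e3_rotT.
rewrite /NPi !mxcol_row_mx (eq_mxcol rotE) /col6.
by rewrite !col_mx_row_mx /col4 !col_mx0.
Qed.

(** This column is an infinitesimal rotation of trajectory and planes about gravity: position,
    velocity and closest points vary by g x P_1, g x V_1 and g x Pi_q. *)
Lemma obs_gravity (k : nat) : (0 < k)%N ->
  obs_mx X pl k *m
    col6 (ins_rot X 1 *m ins_grav X) 0 (- (skew3 (ins_vel X 1) *m ins_grav X)) 0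
         (- (skew3 (ins_pos X 1) *m ins_grav X))
         (\mxcol_q (- (skew3 (cp (pl q)) *m ins_grav X))) = 0.
Proof.
move=> k0; apply: obs_mx_mul_col6 => // q nq.
rewrite /Phi51 -[_ *m _ *m (_ *m ins_grav X)]mulmxA !(mulmxA _^T).
rewrite (SO3_trmul _ (@ins_rot_SO3 _ X 1 isT)) !mul1mx !skew3E.
set g := ins_grav X; set P := ins_pos X k.
(* The P_1 and V_1 terms of [Phi51] cancel against the position and velocity blocks, and g x g =
   0. *)
have -> : cross3 (ins_pos X 1 + ins_dt X k *: ins_vel X 1
      - (2^-1 * ins_dt X k ^+ 2) *: g - P) g
    + ins_dt X k *: - cross3 (ins_vel X 1) g - cross3 (ins_pos X 1) g
    = - cross3 P g.
  rewrite !cross3Dl !cross3Nl !cross3Zl cross3vv.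
  by apply/colP => l; rewrite !mxE; ring.
rewrite mulmxN opprK /cp cross3Zl mulmxN.
rewrite Hpi2_mul_orth ?dot3_crossl // -/nq -/P.
rewrite -mulmxA tr_mul3 mul_mx_scalar (dot3_crossCA P) scaleNr opprK opprD.
by rewrite addrACA subrr add0r subrr.
Qed.

(** Translating sensor and planes by a changes d by n.a and moves the closest point by n n^T a; the
    columns of [A] are such shifts. *)
Lemma obs_translation (A : 'M[R]_3) (k : nat) : (0 < k)%N ->
  obs_mx X pl k *m
    col6 0 0 0 0 A (\mxcol_q (pl_n (pl q) *m (pl_n (pl q))^T *m A)) = 0.
Proof.
move=> k0; apply: obs_mx_mul_col6 => // q nq.
rewrite !mulmx0 !scaler0 !add0r 2!mulmxA Hpi2_normal -/nq.
by rewrite addNr.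
Qed.

(** The velocity error only causes the drift dt v, which is tangent to every plane and leaves all
    distances unchanged. *)
Lemma obs_velocity (v : 'cV[R]_3) (k : nat) : (0 < k)%N ->
  (forall q, dot3 (pl_n (pl q)) v = 0) ->
  obs_mx X pl k *m col6 0 0 v 0 0 (\mxcol_q 0) = 0.
Proof.
move=> k0 nv; apply: obs_mx_mul_col6 => // q nq.
rewrite !mulmx0 scaler0 !add0r !addr0 -scalemxAr -mulmxA tr_mul3 nv.
by rewrite mul_mx_scalar scale0r scaler0 oppr0.
Qed.

Lemma rot_grav_neq0 : ins_rot X 1 *m ins_grav X != 0.
Proof.
apply/eqP => /(congr1 (mulmx (ins_rot X 1)^T)).
rewrite mulmxA (SO3_trmul _ (@ins_rot_SO3 _ X 1 isT)) mul1mx mulmx0.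
move/colP/(_ ord_max); rewrite !mxE !eqxx mulr1 => /eqP.
by rewrite oppr_eq0 gt_eqF ?ins_g_gt0.
Qed.

(** Restates both conditions on the whole matrix, so that block products handle all columns at
    once. *)
Lemma unobservable_directionsP (n : nat) (N : 'M[R]_(idim + (3 + fdim s), n)) :
  (forall z : 'cV[R]_n, N *m z = 0 -> z = 0) ->
  (forall k, (0 < k)%N -> obs_mx X pl k *m N = 0) ->
  unobservable_directions X pl N.
Proof.
move=> Ninj N0; split=> [|l k k0].
  apply/inj_row_free => z zN; apply: trmx_inj; rewrite trmx0; apply: Ninj.
  by rewrite -[N]trmxK -trmx_mul zN trmx0.
by rewrite colE mulmxA N0 // mul0mx.
Qed.

End Observability.

Theorem lemma4p5 (R : realType) (X : ins R) (s : nat) (pl : 'I_s -> plane R)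
    (i j : 'I_s) (hs : (1 < s)%N) (hij : i != j) :
  (s = 2%N -> ~ parallel_planes (pl i) (pl j) ->
     unobservable_directions X pl (NPi X pl i j)) /\
  ((3 <= s)%N -> intersections_not_parallel pl ->
     unobservable_directions X pl (lsubmx (NPi X pl i j))).
Proof.
have scal0 (u : 'cV[R]_3) (z : 'cV[R]_1) : u != 0 -> u *m z = 0 -> z = 0.
  move=> u0; rewrite [z]mx11_scalar mul_mx_scalar => /eqP.
  by rewrite scaler_eq0 (negPf u0) orbF => /eqP->; rewrite raddf0.
have rot0 (z : 'cV[R]_3) : pl_rot (pl i) *m z = 0 -> z = 0.
  move/(congr1 (mulmx (pl_rot (pl i))^T)).
  by rewrite mulmxA SO3_trmul ?mul1mx ?mulmx0 //; apply: pl_rot_SO3.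
rewrite NPiE; split.
- move=> s2 npar; apply: unobservable_directionsP => [z|k k0].
    rewrite -[z]vsubmxK -[usubmx z]vsubmxK !mul_row_col !mul_col6.
    (* Coefficients of the gravity column, the position columns and the last column. *)
    set a := usubmx (usubmx z); set c := dsubmx (usubmx z); set b := dsubmx z.
    rewrite /col6 /col4 !add_col_mx => /col6_eq0[].
    rewrite !mul0mx !addr0 => /(scal0 _ _ (rot_grav_neq0 X)) ->.
    rewrite !mulmx0 !add0r => /scal0-> => [/rot0->|].
      by rewrite !col_mx0.
    by apply/eqP => /cross3_eq0_parallel par; apply/npar/par/pl_n_unit.
  rewrite !mul_mx_row obs_gravity // obs_translation // obs_velocity ?row_mx0 //.
  move=> q; suff [->|->] : q = i \/ q = j; first exact: dot3_crossl.
    exact: dot3_crossr.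
  (* Generalizing over the planes and indices allows [s] to become 2 in their types; the index
     values are then enumerated. *)
  move: pl i j hij q {scal0 rot0 npar hs}; rewrite s2 => _ i j hij q.
  have [->|qi] := eqVneq q i; [by left|right].
  apply: val_inj; move: hij qi; rewrite -!val_eqE /=.
  by case: i j q => [[|[|//]] ?] [[|[|//]] ?] [[|[|//]] ?].
(* Without the cross-product column, independence is read off the orientation rows and then the
   position rows. *)
- move=> _ _; rewrite row_mxKl; apply: unobservable_directionsP => [z|k k0].
    rewrite -[z]vsubmxK mul_row_col !mul_col6 /col6 /col4 !add_col_mx.
    move/col6_eq0 => []; rewrite !mul0mx !addr0.
    move=> /(scal0 _ _ (rot_grav_neq0 X)) -> _.
    by rewrite mulmx0 add0r => /rot0->; rewrite col_mx0.
  by rewrite mul_mx_row obs_gravity // obs_translation // row_mx0.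
Qed.
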